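(* The functors $F\colon\mathsf{Frm}_\wedge\to\mathsf{CDTop}_{\inf}$ and $\mathrm{Pt}\colon\mathsf{CDTop}_{\inf}\to\mathsf{Frm}_\wedge$ define an equivalence of categories.
   Context: For a topological space $X$ the underlying order is $x\le y$ iff $y\in\mathrm{cl}\{x\}$ (the dual of the specialisation order). Continuous maps $f,g\colon X\to Y$ are ordered pointwise with respect to the underlying order of $Y$; $f\dashv g$ ($f\colon X\to Y$, $g\colon Y\to X$ continuous) means $1_X\le g\cdot f$ and $f\cdot g\le 1_Y$. $\mathsf 2=\{0,1\}$ is the Sierpiński space with $\{1\}$ closed (so $0\le 1$). For a meet semi-lattice $L$ (with top element) $FL$ is the set of all filters $\mathfrak f\subseteq L$ (up-closed, containing the top, closed under binary meets, possibly $\mathfrak f=L$), with the topology having the sets $x^\#=\{\mathfrak f\in FL\mid x\in\mathfrak f\}$, $x\in L$, as basic opens. For a meet semi-lattice homomorphism $f\colon L\to M$ (preserving finite meets, including the top), $Ff\colon FL\to FM$, $\mathfrak f\mapsto\,\uparrow\{f(x)\mid x\in\mathfrak f\}$. $\mathcal OX$ is the frame of opens of $X$. $PX$ denotes the filter space $F(\mathcal OX)$ (canonically homeomorphic to the presheaf space $\mathsf 2^{X^{\mathrm{op}}}$), and the Yoneda embedding $y_X\colon X\to PX$ sends $x$ to its filter of open neighbourhoods. $X$ is cocomplete if $y_X$ has a left adjoint $\mathrm{Sup}_X\colon PX\to X$ in $\mathsf{Top}$; a cocomplete $X$ is completely distributive if $\mathrm{Sup}_X$ has a left adjoint $t_X\colon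 X\to PX$ in $\mathsf{Top}$. $\mathsf{Frm}_\wedge$ is the category of frames and finite-meet-preserving maps. $\mathsf{CDTop}_{\inf}$ is the category of completely distributive T$_0$-spaces and continuous maps which are right adjoint in $\mathsf{Top}$. $F$ restricts to a functor $\mathsf{Frm}_\wedge\to\mathsf{CDTop}_{\inf}$. For a space $X$, $\Lambda(X)$ is the set of continuous maps $\varphi\colon X\to\mathsf 2$ which are left adjoint in $\mathsf{Top}$, ordered pointwise. $\mathrm{Pt}(X)=\Lambda(X)^{\mathrm{op}}$ (the opposite ordered set), and for $f\colon X\to Y$ in $\mathsf{CDTop}_{\inf}$ with left adjoint $g\colon Y\to X$, $\mathrm{Pt}(f)\colon\mathrm{Pt}(X)\to\mathrm{Pt}(Y)$ is $\varphi\mapsto\varphi\cdot g$. *)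

(* Defs.v *)
From HB Require Import structures.
From mathcomp Require Import all_boot all_order.
From mathcomp Require Import boolp classical_sets.
From mathcomp Require Import topology_structure separation_axioms.

Set Implicit Arguments.
Unset Strict Implicit.
Unset Printing Implicit Defensive.

Import Order.TTheory.
Local Open Scope classical_set_scope.
Local Open Scope order_scope.

Record category := Category {
  obj :> Type;
  hom : obj -> obj -> Type;
  idm : forall A, hom A A;
  compm : forall A B C, hom B C -> hom A B -> hom A C;
  compm1 : forall A B (f : hom A B), compm f (idm A) = f;
  comp1m : forall A B (f : hom A B), compm (idm B) f = f;
  compmA : forall A B C D (h : hom C D) (g : hom B C) (f : hom A B),
    compm h (compm g f) = compm (compm h g) f }.
Arguments idm {c} A.
Arguments hom {c} A B.

Notation "g '\oc' f" := (compm g f) (at level 50, left associativity).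

Record functor (C D : category) := Functor {
  fobj :> C -> D;
  fmap : forall A B : C, hom A B -> hom (fobj A) (fobj B);
  fmap1 : forall A : C, fmap (idm A) = idm (fobj A);
  fmapM : forall (A B E : C) (g : hom B E) (f : hom A B),
    fmap (g \oc f) = fmap g \oc fmap f }.

Definition functor_id (C : category) : functor C C :=
  @Functor C C id (fun A B f => f) (fun=> erefl) (fun _ _ _ _ _ => erefl).

Section FunctorComp.
Variables (C D E : category) (G : functor D E) (F : functor C D).

Let map A B (f : hom A B) : hom (G (F A)) (G (F B)) := fmap G (fmap F f).

Let map1 A : map (idm A) = idm (G (F A)).
Proof. by rewrite /map !fmap1. Qed.

Let mapM A B H (g : hom B H) (f : hom A B) :
  map (g \oc f) = map g \oc map f.
Proof. by rewrite /map !fmapM. Qed.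

Definition functor_comp : functor C E := Functor map1 mapM.
End FunctorComp.

Definition is_iso (C : category) (A B : C) (f : hom A B) :=
  exists g : hom B A, g \oc f = idm A /\ f \oc g = idm B.

Definition naturally_isomorphic (C D : category) (F G : functor C D) :=
  exists eta : forall A : C, hom (F A) (G A),
    (forall (A B : C) (f : hom A B), eta B \oc fmap F f = fmap G f \oc eta A) /\
    (forall A : C, is_iso (eta A)).

Definition is_equivalence (C D : category)
    (F : functor C D) (G : functor D C) :=
  naturally_isomorphic (functor_id C) (functor_comp G F) /\
  naturally_isomorphic (functor_comp F G) (functor_id D).

(* This is the dual of the specialisation order. *)
Definition under_le (X : topologicalType) (x y : X) := closure [set x] y.

Definition under_le_fun (X : Type) (Y : topologicalType) (f g : X -> Y) :=
  forall x, under_le (f x) (g x).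

Definition adjoint (X Y : topologicalType) (f : X -> Y) (g : Y -> X) :=
  [/\ continuous f, continuous g,
      under_le_fun id (g \o f) & under_le_fun (f \o g) id].

Definition is_left_adjoint (X Y : topologicalType) (f : X -> Y) :=
  exists g, adjoint f g.

Definition is_right_adjoint (X Y : topologicalType) (g : Y -> X) :=
  exists f, adjoint f g.

Section UnderLe.
Implicit Types X Y Z : topologicalType.

Lemma under_leP X (x y : X) :
  under_le x y <-> forall U, open U -> U y -> U x.
Proof.
split=> [xy U oU Uy|H B].
  by have [z [/= -> ]] := xy U (open_nbhs_nbhs (conj oU Uy)).
rewrite nbhsE => -[U [oU Uy] UB]; by exists x; split=> //; apply: UB; apply: H.
Qed.

Lemma under_le_refl X (x : X) : under_le x x.
Proof. by apply/under_leP. Qed.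

Lemma under_le_trans X (y x z : X) :
  under_le x y -> under_le y z -> under_le x z.
Proof.
move=> /under_leP xy /under_leP yz; apply/under_leP => U oU Uz.
by apply: xy => //; apply: yz.
Qed.

Lemma under_le_anti X (x y : X) : kolmogorov_space X ->
  under_le x y -> under_le y x -> x = y.
Proof.
move=> T0 /under_leP xy /under_leP yx; apply: contrapT => /eqP /T0[A].
rewrite !inE !nbhsE /= => -[[[U [oU Ux] UA] nA]|[[U [oU Uy] UA] nA]].
  by apply: nA; apply: UA; apply: yx.
by apply: nA; apply: UA; apply: xy.
Qed.

Lemma under_le_homo X Y (f : X -> Y) x y : continuous f ->
  under_le x y -> under_le (f x) (f y).
Proof.
move=> /continuousP cf /under_leP xy; apply/under_leP => U oU.
exact: (xy (f @^-1` U) (cf _ oU)).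
Qed.

Lemma continuous_comp_fun X Y Z (f : X -> Y) (g : Y -> Z) :
  continuous f -> continuous g -> continuous (g \o f).
Proof.
move=> /continuousP cf /continuousP cg; apply/continuousP => U oU.
exact: (cf (g @^-1` U) (cg _ oU)).
Qed.

Lemma adjoint_id X : adjoint (@idfun X) idfun.
Proof.
by split=> [||x|x]; try (by apply/continuousP); apply: under_le_refl.
Qed.

Lemma adjoint_comp X Y Z (f : X -> Y) (g : Y -> X) (h : Y -> Z) (k : Z -> Y) :
  adjoint f g -> adjoint h k -> adjoint (h \o f) (g \o k).
Proof.
move=> [cf cg fg gf] [ch ck hk kh]; split; try exact: continuous_comp_fun.
  move=> x; apply: under_le_trans (fg x) _ => /=.
  by apply: under_le_homo; [|apply: hk].
move=> z; apply: (under_le_trans _ (kh z)) => /=.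
by apply: under_le_homo; [|apply: gf].
Qed.

Lemma adjointP X Y (f : X -> Y) (g : Y -> X) : adjoint f g ->
  forall x y, under_le (f x) y <-> under_le x (g y).
Proof.
move=> [cf cg fg gf] x y; split=> h.
  exact: under_le_trans (fg x) (under_le_homo cg h).
exact: under_le_trans (under_le_homo cf h) (gf y).
Qed.

Lemma left_adjoint_unique X Y (f f' : X -> Y) (g : Y -> X) :
  kolmogorov_space Y -> adjoint f g -> adjoint f' g -> f = f'.
Proof.
move=> T0 fg f'g; apply/funext => x; apply: under_le_anti => //.
  by apply/(adjointP fg)/(adjointP f'g); apply: under_le_refl.
by apply/(adjointP f'g)/(adjointP fg); apply: under_le_refl.
Qed.

End UnderLe.

(* An alias, as the library equips bool with the discrete topology. *)
Definition sierpinski : Type := bool.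
HB.instance Definition _ := Choice.copy sierpinski bool.

(* The open sets are set0, [set false] and setT. *)
Definition sierpinski_open : set_system sierpinski :=
  [set U | U true -> U false].

Lemma sierpinski_openT : sierpinski_open setT. Proof. by []. Qed.

Lemma sierpinski_openI : setI_closed sierpinski_open.
Proof. by move=> A B oA oB [/oA ? /oB ?]. Qed.

Lemma sierpinski_open_bigcup (I : Type) (f : I -> set sierpinski) :
  (forall i, sierpinski_open (f i)) -> sierpinski_open (\bigcup_i f i).
Proof. by move=> of_ [i _ /of_ ?]; exists i. Qed.

HB.instance Definition _ := isOpenTopological.Build sierpinski
  sierpinski_openT sierpinski_openI sierpinski_open_bigcup.

Lemma sierpinski_openE (U : set sierpinski) : open U = (U true -> U false).
Proof. by []. Qed.

Lemma sierpinski_leP (a b : sierpinski) :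
  under_le a b <-> (a ==> b :> bool).
Proof.
split=> [/under_leP|].
  case: a b => -[] //= h.
  by have := h [set false] (fun e => erefl) erefl.
case: a b => -[] //= _; try exact: under_le_refl.
by apply/under_leP => U oU; apply: oU.
Qed.

HB.mixin Record TBLattice_isFrame d L of Order.TBLattice d L := {
  frame_sup : set L -> L;
  frame_sup_ub : forall (A : set L) a, A a -> a <= frame_sup A;
  frame_sup_le : forall (A : set L) b, (forall a, A a -> a <= b) ->
    frame_sup A <= b;
  meet_frame_sup : forall x (A : set L),
    x `&` frame_sup A = frame_sup [set x `&` a | a in A] }.

#[short(type="frameType")]
HB.structure Definition Frame d :=
  { L of Order.TBLattice d L & TBLattice_isFrame d L }.

Definition meet_hom d d' (L : tMeetSemilatticeType d)
    (M : tMeetSemilatticeType d') (f : L -> M) :=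
  f \top = \top /\ {morph f : x y / x `&` y}.

Lemma meet_hom_homo d d' (L : tMeetSemilatticeType d)
    (M : tMeetSemilatticeType d') (f : L -> M) :
  meet_hom f -> {homo f : x y / x <= y}.
Proof. by move=> [_ fI] x y /meet_idPl xy; rewrite -xy fI leIr. Qed.

#[local] Identity Coercion fun_of_set : set >-> Funclass.

Record opens (X : topologicalType) := Opens {
  opens_set :> set X;
  opensP : open opens_set }.

Fact opens_display : Order.disp_t. Proof. exact: Order.Disp tt tt. Qed.

Section OpensFrame.
Variable X : topologicalType.
Implicit Types U V W : opens X.

HB.instance Definition _ := gen_eqMixin (opens X).
HB.instance Definition _ := gen_choiceMixin (opens X).

Lemma opens_inj U V : U = V :> set X -> U = V.
Proof.
by case: U V => [U oU] [V oV] /= e; subst V; congr Opens; apply: Prop_irrelevance.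
Qed.

Definition opens_le U V := `[< U `<=` V >].

Lemma opens_le_refl : reflexive opens_le.
Proof. by move=> U; apply/asboolP. Qed.

Lemma opens_le_anti : antisymmetric opens_le.
Proof.
by move=> U V /andP[/asboolP UV /asboolP VU]; apply/opens_inj/seteqP; split.
Qed.

Lemma opens_le_trans : transitive opens_le.
Proof.
move=> V U W /asboolP UV /asboolP VW; apply/asboolP.
exact: subset_trans VW.
Qed.

HB.instance Definition _ := Order.Le_isPOrder.Build opens_display (opens X)
  opens_le_refl opens_le_anti opens_le_trans.

Lemma leEopens U V : (U <= V) = `[< U `<=` V >]. Proof. by []. Qed.

Definition opens_top : opens X := Opens openT.
Definition opens_bottom : opens X := Opens open0.
Definition opens_meet U V := Opens (openI (opensP U) (opensP V)).
Definition opens_join U V := Opens (openU (opensP U) (opensP V)).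

Lemma opens_lex1 U : U <= opens_top. Proof. exact/asboolP. Qed.
Lemma opens_le0x U : opens_bottom <= U. Proof. exact/asboolP. Qed.

Lemma opens_lexI U V W : (U <= opens_meet V W) = (U <= V) && (U <= W).
Proof.
rewrite !leEopens; apply/asboolP/andP => [h|[/asboolP h1 /asboolP h2]].
  by split; apply/asboolP => x /h[].
by move=> x Ux; split; [apply: h1|apply: h2].
Qed.

Lemma opens_leUx U V W : (opens_join U V <= W) = (U <= W) && (V <= W).
Proof.
rewrite !leEopens; apply/asboolP/andP => [h|[/asboolP h1 /asboolP h2]].
  by split; apply/asboolP => x Ux; apply: h; [left|right].
by move=> x []; [apply: h1|apply: h2].
Qed.

HB.instance Definition _ := Order.POrder_MeetJoin_isLattice.Build
  opens_display (opens X) opens_lexI opens_leUx.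
HB.instance Definition _ := Order.hasTop.Build
  opens_display (opens X) opens_lex1.
HB.instance Definition _ := Order.hasBottom.Build
  opens_display (opens X) opens_le0x.

Definition opens_sup (A : set (opens X)) : opens X :=
  Opens (bigcup_open (fun U (_ : A U) => opensP U)).

Lemma opens_sup_ub (A : set (opens X)) U : A U -> U <= opens_sup A.
Proof. by move=> AU; apply/asboolP => x Ux; exists U. Qed.

Lemma opens_sup_le (A : set (opens X)) V :
  (forall U, A U -> U <= V) -> opens_sup A <= V.
Proof. by move=> h; apply/asboolP => x [U /h /asboolP]; apply. Qed.

Lemma opens_meet_sup U (A : set (opens X)) :
  U `&` opens_sup A = opens_sup [set U `&` V | V in A].
Proof.
apply/opens_inj/seteqP; split=> x.
  by move=> [Ux [V AV Vx]]; exists (U `&` V) => //; exists V.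
by move=> [_ [V AV <-] [Ux Vx]]; split=> //; exists V.
Qed.

HB.instance Definition _ := TBLattice_isFrame.Build opens_display (opens X)
  opens_sup_ub opens_sup_le opens_meet_sup.

End OpensFrame.

(* The improper filter setT is allowed. *)
Definition is_lfilter d (L : tMeetSemilatticeType d) (f : set L) :=
  [/\ forall x y : L, x <= y -> f x -> f y,
      f \top & forall x y : L, f x -> f y -> f (x `&` y)].

Record lfilter d (L : tMeetSemilatticeType d) := LFilter {
  lfilter_set :> set L;
  lfilterP : is_lfilter lfilter_set }.

Section FilterSpace.
Variables (d : Order.disp_t) (L : tMeetSemilatticeType d).
Implicit Types (f g : lfilter L) (x y : L).

HB.instance Definition _ := gen_eqMixin (lfilter L).
HB.instance Definition _ := gen_choiceMixin (lfilter L).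

Lemma lfilter_inj f g : f = g :> set L -> f = g.
Proof.
by case: f g => [f fP] [g gP] /= e; subst g; congr LFilter; apply: Prop_irrelevance.
Qed.

Lemma lfilterS f x y : x <= y -> f x -> f y.
Proof. by case: (lfilterP f) => h _ _; apply: h. Qed.

Lemma lfilterT f : f \top.
Proof. by case: (lfilterP f). Qed.

Lemma lfilterI f x y : f x -> f y -> f (x `&` y).
Proof. by case: (lfilterP f) => _ _; apply. Qed.

Definition sharp (x : L) : set (lfilter L) := [set f | f x].

Definition lfilter_open : set_system (lfilter L) :=
  [set \bigcup_(x in D) sharp x | D in [set: set L]].

Lemma lfilter_openP (A : set (lfilter L)) : lfilter_open A <->
  forall f, A f -> exists2 x, f x & sharp x `<=` A.
Proof.
split=> [[D _ <-] f [x Dx fx]|h].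
  by exists x => // g gx; exists x.
exists [set x | sharp x `<=` A] => //; apply/seteqP; split.
  by move=> f [x xA fx]; apply: xA.
by move=> f /h[x fx xA]; exists x.
Qed.

Lemma lfilter_openT : lfilter_open setT.
Proof. by apply/lfilter_openP => f _; exists \top => //; apply: lfilterT. Qed.

Lemma lfilter_openI : setI_closed lfilter_open.
Proof.
move=> A B /lfilter_openP oA /lfilter_openP oB; apply/lfilter_openP => f [].
move=> /oA[x fx xA] /oB[y fy yB]; exists (x `&` y); first exact: lfilterI.
move=> g gxy; split.
  by apply: xA; apply: lfilterS gxy; apply: leIl.
by apply: yB; apply: lfilterS gxy; apply: leIr.
Qed.

Lemma lfilter_open_bigcup (I : Type) (F : I -> set (lfilter L)) :
  (forall i, lfilter_open (F i)) -> lfilter_open (\bigcup_i F i).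
Proof.
move=> oF; apply/lfilter_openP => f [i _].
have /lfilter_openP h := oF i; move=> /h[x fx xF].
by exists x => // g /xF; exists i.
Qed.

HB.instance Definition _ := isOpenTopological.Build (lfilter L)
  lfilter_openT lfilter_openI lfilter_open_bigcup.

Lemma lfilter_openE (A : set (lfilter L)) : open A <->
  forall f, A f -> exists2 x, f x & sharp x `<=` A.
Proof. exact: lfilter_openP. Qed.

Lemma open_sharp x : open (sharp x).
Proof. by apply/lfilter_openE => f fx; exists x. Qed.

Lemma lfilter_leP f g : under_le f g <-> g `<=` f.
Proof.
split=> [/under_leP fg x gx|gf]; first exact: (fg _ (open_sharp x)).
apply/under_leP => U /lfilter_openE oU /oU[x gx]; apply; exact: gf.
Qed.

Lemma lfilter_T0 : kolmogorov_space (lfilter L).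
Proof.
move=> f g /eqP fg.
have nbhs_sharp x (h : lfilter L) : h x -> nbhs h (sharp x).
  by move=> hx; apply: open_nbhs_nbhs; split=> //; apply: open_sharp.
have [[x [fx gx]]|h] := pselect (exists x, f x /\ ~ g x).
  by exists (sharp x); left; rewrite !inE; split; [apply: nbhs_sharp|].
have [[x [gx fx]]|h'] := pselect (exists x, g x /\ ~ f x).
  by exists (sharp x); right; rewrite !inE; split; [apply: nbhs_sharp|].
exfalso; apply: fg; apply/lfilter_inj/seteqP.
by split=> x ?; apply: contrapT => ?; [apply: h|apply: h']; exists x.
Qed.

Lemma lfilter_continuous (X : topologicalType) (h : X -> lfilter L) :
  (forall x, open (h @^-1` sharp x)) -> continuous h.
Proof.
move=> oh; apply/continuousP => U [D _ <-].
by rewrite preimage_bigcup; apply: bigcup_open => x _; apply: oh.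
Qed.

Lemma is_lfilter_principal x : is_lfilter [set y | x <= y].
Proof.
split=> [y z yz /= xy||y z /= xy xz]; first exact: le_trans yz.
  exact: lex1.
by rewrite lexI xy.
Qed.

Definition principal x : lfilter L := LFilter (is_lfilter_principal x).

End FilterSpace.

Section FilterMap.
Variables (d d' : Order.disp_t).
Variables (L : tMeetSemilatticeType d) (M : tMeetSemilatticeType d').
Variables (h : L -> M) (hP : meet_hom h).

Lemma is_lfilter_image (f : lfilter L) :
  is_lfilter [set y | exists2 x, f x & h x <= y].
Proof.
split=> [x y xy [z fz zx]||x y [u fu ux] [v fv vy]].
- by exists z => //; apply: le_trans xy.
- by exists \top; [apply: lfilterT|apply: lex1].
- exists (u `&` v); first exact: lfilterI.
  by rewrite hP.2; apply: leI2.
Qed.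

Definition lfilter_map (f : lfilter L) : lfilter M :=
  LFilter (is_lfilter_image f).

Lemma is_lfilter_preimage (g : lfilter M) : is_lfilter (h @^-1` g).
Proof.
split=> [x y xy||x y] /=.
- by apply: lfilterS; apply: meet_hom_homo.
- by rewrite hP.1; apply: lfilterT.
- by rewrite hP.2; apply: lfilterI.
Qed.

Definition lfilter_comap (g : lfilter M) : lfilter L :=
  LFilter (is_lfilter_preimage g).

Lemma lfilter_map_adjoint : adjoint lfilter_comap lfilter_map.
Proof.
split.
- by apply: lfilter_continuous => x; apply: (open_sharp (h x)).
- apply: lfilter_continuous => y; apply/lfilter_openE => f [x fx xy].
  by exists x => // g gx; exists x.
- move=> g; apply/lfilter_leP => y [x gx xy].
  exact: (lfilterS xy gx).
- move=> f; apply/lfilter_leP => x fx; by exists x.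
Qed.

End FilterMap.

Definition presheaf (X : topologicalType) : topologicalType :=
  lfilter (opens X).

Lemma is_lfilter_nbhs (X : topologicalType) (x : X) :
  is_lfilter [set U : opens X | U x].
Proof. by split=> // U V /asboolP UV /UV. Qed.

Definition yoneda (X : topologicalType) (x : X) : presheaf X :=
  LFilter (is_lfilter_nbhs x).

Definition cocomplete (X : topologicalType) := is_right_adjoint (@yoneda X).

(* Sup is only determined up to equivalence if X is not T0, but whether it     *)
(* has a left adjoint does not depend on its choice.                           *)
Definition completely_distributive (X : topologicalType) :=
  exists Sup : presheaf X -> X,
    adjoint Sup (@yoneda X) /\ is_right_adjoint Sup.

Record cdtop := CDTop {
  cdtop_space :> topologicalType;
  cdtop_T0 : kolmogorov_space cdtop_space;
  cdtop_cd : completely_distributive cdtop_space }.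

Section FilterSpaceCD.
Variables (d : Order.disp_t) (L : frameType d).

Definition opens_sharp (x : L) : opens (lfilter L) := Opens (open_sharp x).

Lemma opens_sharp_top : opens_sharp \top = \top.
Proof.
by apply/opens_inj/seteqP; split=> // f _; apply: (lfilterT f).
Qed.

Lemma opens_sharpI x y : opens_sharp (x `&` y) = opens_sharp x `&` opens_sharp y.
Proof.
apply/opens_inj/seteqP; split=> f /= fxy.
  split; apply: (lfilterS _ fxy); [exact: leIl|exact: leIr].
by case: fxy => fx fy; apply: (lfilterI fx fy).
Qed.

Lemma meet_hom_sharp : meet_hom opens_sharp.
Proof. split; [exact: opens_sharp_top|exact: opens_sharpI]. Qed.

Definition lfilter_Sup (G : presheaf (lfilter L)) : lfilter L :=
  lfilter_comap meet_hom_sharp G.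

Definition core (U : opens (lfilter L)) : L :=
  frame_sup [set x | sharp x `<=` U].

Lemma core_homo : {homo core : U V / U <= V}.
Proof.
move=> U V /asboolP UV; apply: frame_sup_le => x xU.
by apply: frame_sup_ub; apply: subset_trans UV.
Qed.

Lemma core_sharp x : core (opens_sharp x) = x.
Proof.
apply/eqP; rewrite eq_le; apply/andP; split.
  by apply: frame_sup_le => y /(_ (principal y)); apply; apply: lexx.
by apply: frame_sup_ub.
Qed.

Lemma coreT : core \top = \top.
Proof. by rewrite -opens_sharp_top core_sharp. Qed.

Lemma coreI : {morph core : U V / U `&` V}.
Proof.
move=> U V; apply/eqP; rewrite eq_le lexI; apply/andP; split.
  by rewrite !core_homo ?leIl ?leIr.
rewrite {2}/core meet_frame_sup; apply: frame_sup_le => _ [y yV <-].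
rewrite meetC /core meet_frame_sup; apply: frame_sup_le => _ [x xU <-].
apply: frame_sup_ub => f fyx; split.
  by apply: xU; apply: (lfilterS _ fyx); apply: leIr.
by apply: yV; apply: (lfilterS _ fyx); apply: leIl.
Qed.

Lemma meet_hom_core : meet_hom core.
Proof. split; [exact: coreT|exact: coreI]. Qed.

Definition lfilter_t (f : lfilter L) : presheaf (lfilter L) :=
  lfilter_comap meet_hom_core f.

Lemma lfilter_Sup_adjoint : adjoint lfilter_Sup (@yoneda (lfilter L)).
Proof.
split.
- by have [] := lfilter_map_adjoint meet_hom_sharp.
- by apply: lfilter_continuous => U; apply: opensP.
- move=> G; apply/lfilter_leP => U /= USup.
  have /lfilter_openE/(_ _ USup)[x Gx xU] := opensP U.
  apply: (@lfilterS _ _ G (opens_sharp x)) => //; exact/asboolP.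
- by move=> f; apply/lfilter_leP.
Qed.

Lemma lfilter_t_adjoint : adjoint lfilter_t lfilter_Sup.
Proof.
split.
- by have [] := lfilter_map_adjoint meet_hom_core.
- by have [] := lfilter_map_adjoint meet_hom_sharp.
- by move=> f; apply/lfilter_leP => x /=; rewrite core_sharp.
- move=> G; apply/lfilter_leP => U GU /=; apply: lfilterS GU.
  apply/asboolP => f Uf; have /lfilter_openE/(_ _ Uf)[x fx xU] := opensP U.
  by apply: (lfilterS _ fx); apply: frame_sup_ub.
Qed.

Lemma lfilter_cd : completely_distributive (lfilter L).
Proof.
exists lfilter_Sup; split; first exact: lfilter_Sup_adjoint.
by exists lfilter_t; apply: lfilter_t_adjoint.
Qed.

Definition filter_space : cdtop := CDTop (@lfilter_T0 _ L) lfilter_cd.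

End FilterSpaceCD.

Record Lambda (X : topologicalType) := MkLambda {
  Lambda_fun :> X -> sierpinski;
  LambdaP : is_left_adjoint Lambda_fun }.

Fact Lambda_display : Order.disp_t. Proof. exact: Order.Disp tt tt. Qed.

Section LambdaOrder.
Variable X : topologicalType.
Implicit Types phi psi : Lambda X.

HB.instance Definition _ := gen_eqMixin (Lambda X).
HB.instance Definition _ := gen_choiceMixin (Lambda X).

Lemma Lambda_inj phi psi : phi =1 psi -> phi = psi.
Proof.
case: phi psi => [f fP] [g gP] /= /funext e; subst g.
by congr MkLambda; apply: Prop_irrelevance.
Qed.

Definition Lambda_le phi psi := `[< under_le_fun phi psi >].

Lemma Lambda_le_refl : reflexive Lambda_le.
Proof. by move=> phi; apply/asboolP => x; apply: under_le_refl. Qed.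

Lemma Lambda_le_anti : antisymmetric Lambda_le.
Proof.
move=> phi psi /andP[/asboolP h /asboolP h']; apply: Lambda_inj => x.
have /sierpinski_leP := h x; have /sierpinski_leP := h' x.
by case: (phi x) (psi x) => -[].
Qed.

Lemma Lambda_le_trans : transitive Lambda_le.
Proof.
move=> psi phi chi /asboolP h /asboolP h'; apply/asboolP => x.
exact: under_le_trans (h x) (h' x).
Qed.

HB.instance Definition _ := Order.Le_isPOrder.Build Lambda_display (Lambda X)
  Lambda_le_refl Lambda_le_anti Lambda_le_trans.

End LambdaOrder.

Definition Pt (X : cdtop) : Type := (Lambda X)^d.
HB.instance Definition _ (X : cdtop) := Order.POrder.on (Pt X).

(* Pt X is a frame: a map phi in Lambda X corresponds to the point r whose    *)
(* down-set is the open set of zeros of phi, and the existence of t makes the *)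
(* closure operator U |-> down-set of Sup of the principal filter of U a      *)
(* nucleus on the frame of open sets.                                         *)
Section PtFrame.
Variable X : cdtop.
Implicit Types (phi psi : Pt X) (U V : opens X) (x y z r : X).

Lemma PtE phi psi :
  phi <= psi <-> forall x, (phi : Lambda X) x = false -> (psi : Lambda X) x = false.
Proof.
rewrite [_ <= _]/(@Order.le _ (Lambda X) psi phi); split.
  move=> /asboolP h x phix; have /sierpinski_leP := h x.
  by rewrite phix; case: ((psi : Lambda X) x).
move=> h; apply/asboolP => x; apply/sierpinski_leP.
have := h x; case: ((phi : Lambda X) x); first by rewrite implybT.
by move=> ->.
Qed.


Lemma nucleus_exists : exists s : opens X -> X,
  [/\ forall U, open [set z | under_le z (s U)],
      forall z, under_le z (s \top),
      forall U V z, under_le z (s U) -> under_le z (s V) ->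
        under_le z (s (U `&` V)),
      forall U z, U z -> under_le z (s U) &
      forall U r, (forall z, U z -> under_le z r) ->
        under_le (s U) r].
Proof.
have [Sup [SupA [t tA]]] := cdtop_cd X.
have tP U z : under_le z (Sup (principal U)) <-> t z U.
  rewrite -(adjointP tA); split=> [/lfilter_leP|tU]; first by apply; apply: lexx.
  by apply/lfilter_leP => V UV; apply: lfilterS tU.
exists (Sup \o @principal _ _); split=> [U|z|U V z /tP tU /tP tV|U z Uz|U r Ur] /=.
- have [/continuousP ct _ _ _] := tA.
  rewrite (_ : [set _ | _] = t @^-1` sharp U); first exact/ct/open_sharp.
  by apply/seteqP; split=> z /tP.
- by apply/tP; apply: lfilterT.
- by apply/tP; apply: lfilterI.
- have [cSup _ /(_ (yoneda z))/lfilter_leP/= ySup _] := SupA.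
  apply: (@under_le_trans _ (Sup (yoneda z))).
    by apply/under_leP => V oV; apply: (ySup (Opens oV)).
  by apply: under_le_homo => //; apply/lfilter_leP => V /asboolP; apply.
- apply/(adjointP SupA)/lfilter_leP => V Vr; apply/asboolP => z /Ur.
  by move=> /under_leP; apply => //; apply: opensP.
Qed.

Definition nucleus : opens X -> X := projT1 (cid nucleus_exists).

Lemma nucleus_open U : open [set z | under_le z (nucleus U)].
Proof. by rewrite /nucleus; case: cid => s /= []. Qed.

Lemma nucleus_top z : under_le z (nucleus \top).
Proof. by rewrite /nucleus; case: cid => s /= []. Qed.

Lemma nucleusI U V z : under_le z (nucleus U) -> under_le z (nucleus V) ->
  under_le z (nucleus (U `&` V)).
Proof. by rewrite /nucleus; case: cid => s /= [_ _ + _ _]; apply. Qed.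

Lemma nucleus_ge U z : U z -> under_le z (nucleus U).
Proof. by rewrite /nucleus; case: cid => s /= [_ _ _ + _]; apply. Qed.

Lemma nucleus_le U r :
  (forall z, U z -> under_le z r) -> under_le (nucleus U) r.
Proof. by rewrite /nucleus; case: cid => s /= [_ _ _ _]; apply. Qed.

Lemma LambdaE (phi : X -> sierpinski) : is_left_adjoint phi <->
  exists2 r, open [set z | under_le z r] &
    forall z, phi z = false <-> under_le z r.
Proof.
split=> [[g phig]|[r or rP]].
  have zP z : phi z = false <-> under_le z (g false).
    rewrite -(adjointP phig); split=> [->|/sierpinski_leP].
      exact: under_le_refl.
    by case: (phi z).
  exists (g false) => //; have [/continuousP cphi _ _ _] := phig.
  rewrite (_ : [set _ | _] = phi @^-1` [set false]); first exact: cphi.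
  by apply/seteqP; split=> z /zP.
exists (fun b : sierpinski => if b then nucleus \top else r); split.
- apply/continuousP => U; rewrite sierpinski_openE => oU.
  have [Ut|Ut] := pselect (U true).
    rewrite (_ : _ @^-1` _ = setT); first exact: openT.
    by apply/seteqP; split=> // z _ /=; case: (phi z) => //; apply: oU.
  have [Uf|Uf] := pselect (U false).
    rewrite (_ : _ @^-1` _ = [set z | under_le z r]) //.
    apply/seteqP; split=> z /= => [Uz|/rP ->//].
    by apply/rP; case: (phi z) Uz.
  rewrite (_ : _ @^-1` _ = set0); first exact: open0.
  by apply/seteqP; split=> z //=; case: (phi z).
- apply/continuousP => U oU; rewrite sierpinski_openE /=.
  by apply: (proj1 (under_leP _ _) (nucleus_top r)).
- move=> z /=; case e: (phi z); first exact: nucleus_top.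
  by apply/rP.
- case=> /=; apply/sierpinski_leP; rewrite ?implybT ?implybF //=.
  by rewrite (proj2 (rP r) (@under_le_refl _ r)).
Qed.

Definition point phi : X := projT1 (cid2 (proj1 (LambdaE phi) (LambdaP phi))).

Lemma point_open phi : open [set z | under_le z (point phi)].
Proof. by rewrite /point; case: cid2. Qed.

Lemma pointP phi z : (phi : Lambda X) z = false <-> under_le z (point phi).
Proof. by rewrite /point; case: cid2. Qed.

Lemma of_point_subproof r : open [set z | under_le z r] ->
  is_left_adjoint (fun z => ~~ `[< under_le z r >] : sierpinski).
Proof.
move=> or; apply/LambdaE; exists r => // z.
by split=> [/negbFE/asboolP|/asboolP ->].
Qed.

Definition of_point r (or : open [set z | under_le z r]) : Pt X :=
  MkLambda (of_point_subproof or).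

Lemma of_pointP r (or : open [set z | under_le z r]) z :
  (of_point or : Lambda X) z = false <-> under_le z r.
Proof. by split=> [/negbFE/asboolP|/asboolP h]; last by rewrite /= h. Qed.

Lemma point_leP phi psi : phi <= psi <-> under_le (point phi) (point psi).
Proof.
rewrite PtE; split=> [h|h z /pointP zphi].
  by apply/pointP/h/pointP; apply: under_le_refl.
by apply/pointP; apply: under_le_trans h.
Qed.

Definition zeros phi : opens X := Opens (point_open phi).

Definition Pt_sup (A : set (Pt X)) : Pt X :=
  of_point (nucleus_open (opens_sup [set zeros a | a in A])).

Lemma Pt_sup_ub (A : set (Pt X)) a : A a -> a <= Pt_sup A.
Proof.
move=> Aa; apply/PtE => z /pointP za; apply/of_pointP/nucleus_ge.
by exists (zeros a) => //; exists a.
Qed.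

Lemma Pt_sup_le (A : set (Pt X)) b : (forall a, A a -> a <= b) -> Pt_sup A <= b.
Proof.
move=> h; apply/PtE => z /of_pointP zs; apply/pointP.
apply: under_le_trans zs _; apply: nucleus_le => w [_ [a Aa <-]] /= wa.
by apply: under_le_trans wa _; apply/point_leP/h.
Qed.

Definition Pt_join phi psi := Pt_sup [set phi; psi].

Lemma Pt_leUx phi psi chi : (Pt_join phi psi <= chi) = (phi <= chi) && (psi <= chi).
Proof.
apply/idP/andP => [h|[h1 h2]].
  by split; apply: le_trans h; apply: Pt_sup_ub; [left|right].
by apply: Pt_sup_le => a [->|->].
Qed.

Lemma Pt_meet_subproof phi psi :
  is_left_adjoint
    (fun x => ((phi : Lambda X) x || (psi : Lambda X) x) : sierpinski).
Proof.
apply/LambdaE; exists (nucleus (zeros phi `&` zeros psi)).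
  exact: nucleus_open.
move=> z; split=> [/negbT|zs].
  rewrite negb_or => /andP[/negbTE/pointP h /negbTE/pointP h'].
  by apply: nucleus_ge.
have /pointP -> : under_le z (point phi).
  by apply: under_le_trans zs _; apply: nucleus_le => w [].
suff /pointP -> : under_le z (point psi) by [].
by apply: under_le_trans zs _; apply: nucleus_le => w [].
Qed.

Definition Pt_meet phi psi : Pt X := MkLambda (Pt_meet_subproof phi psi).

Lemma Pt_lexI phi psi chi : (phi <= Pt_meet psi chi) = (phi <= psi) && (phi <= chi).
Proof.
apply/idP/andP => [/PtE h|[/PtE h1 /PtE h2]].
  by split; apply/PtE => z /h/negbT; rewrite negb_or => /andP[/negbTE ? /negbTE].
by apply/PtE => z zphi /=; rewrite h1 ?h2.
Qed.

Lemma Pt_top_subproof : is_left_adjoint (fun _ : X => false : sierpinski).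
Proof.
apply/LambdaE; exists (nucleus \top); first exact: nucleus_open.
by move=> z; split=> // _; apply: nucleus_top.
Qed.

Definition Pt_top : Pt X := MkLambda Pt_top_subproof.

Lemma Pt_lex1 phi : phi <= Pt_top. Proof. by apply/PtE. Qed.

Definition Pt_bottom : Pt X := Pt_sup set0.

Lemma Pt_le0x phi : Pt_bottom <= phi. Proof. exact: Pt_sup_le. Qed.

HB.instance Definition _ := Order.POrder_MeetJoin_isLattice.Build
  _ (Pt X) Pt_lexI Pt_leUx.
HB.instance Definition _ := Order.hasTop.Build _ (Pt X) Pt_lex1.
HB.instance Definition _ := Order.hasBottom.Build _ (Pt X) Pt_le0x.

Lemma Pt_meet_sup phi (A : set (Pt X)) :
  phi `&` Pt_sup A = Pt_sup [set phi `&` a | a in A].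
Proof.
apply/eqP; rewrite eq_le; apply/andP; split; last first.
  apply: Pt_sup_le => _ [a Aa <-]; rewrite lexI leIl /=.
  by apply: le_trans (leIr _ _) _; apply: Pt_sup_ub.
apply/PtE => z /negbT; rewrite negb_or => /andP[/negbTE/pointP zphi].
move=> /negbTE/of_pointP zA; apply/of_pointP.
have zphi' : under_le z (nucleus (zeros phi)) by apply: nucleus_ge.
apply: under_le_trans (nucleusI zphi' zA) _; apply: nucleus_le => w [wphi].
move=> [_ [a Aa <-] wa]; apply: nucleus_ge.
exists (zeros (phi `&` a)); first by exists (phi `&` a) => //; exists a.
apply/pointP; rewrite /Order.meet /=.
by have /pointP -> := wphi; have /pointP -> := wa.
Qed.

HB.instance Definition _ := TBLattice_isFrame.Build _ (Pt X)
  Pt_sup_ub Pt_sup_le Pt_meet_sup.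

End PtFrame.

Record frame := MkFrame {
  frame_disp : Order.disp_t;
  frame_sort :> frameType frame_disp }.

Record frame_hom (L M : frame) := FrameHom {
  frame_fun :> L -> M;
  frame_funP : meet_hom frame_fun }.

Lemma frame_hom_inj (L M : frame) (f g : frame_hom L M) : f =1 g -> f = g.
Proof.
case: f g => [f fP] [g gP] /= /funext e; subst g.
by congr FrameHom; apply: Prop_irrelevance.
Qed.

Lemma meet_hom_id (L : frame) : meet_hom (@idfun L).
Proof. by []. Qed.

Lemma meet_hom_comp (L M N : frame) (g : frame_hom M N) (f : frame_hom L M) :
  meet_hom (g \o f).
Proof.
have [[fT fI] [gT gI]] := (frame_funP f, frame_funP g).
by split=> [|x y] /=; rewrite ?fT ?gT ?fI ?gI.
Qed.

Definition frame_id (A : frame) : frame_hom A A := FrameHom (@meet_hom_id A).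

Definition frame_comp (A B C : frame) (g : frame_hom B C) (f : frame_hom A B) :
    frame_hom A C := FrameHom (meet_hom_comp g f).

Lemma frame_compm1 (A B : frame) (f : frame_hom A B) :
  frame_comp f (frame_id A) = f.
Proof. exact: frame_hom_inj. Qed.

Lemma frame_comp1m (A B : frame) (f : frame_hom A B) :
  frame_comp (frame_id B) f = f.
Proof. exact: frame_hom_inj. Qed.

Lemma frame_compmA (A B C D : frame) (h : frame_hom C D) (g : frame_hom B C)
    (f : frame_hom A B) :
  frame_comp h (frame_comp g f) = frame_comp (frame_comp h g) f.
Proof. exact: frame_hom_inj. Qed.

Definition Frm_meet : category :=
  Category frame_compm1 frame_comp1m frame_compmA.

Record cdtop_hom (X Y : cdtop) := CDTopHom {
  cdtop_fun :> X -> Y;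
  cdtop_funP : is_right_adjoint cdtop_fun }.

Lemma cdtop_hom_inj (X Y : cdtop) (f g : cdtop_hom X Y) : f =1 g -> f = g.
Proof.
case: f g => [f fP] [g gP] /= /funext e; subst g.
by congr CDTopHom; apply: Prop_irrelevance.
Qed.

Lemma is_right_adjoint_id (X : cdtop) : is_right_adjoint (@idfun X).
Proof. by exists idfun; apply: adjoint_id. Qed.

Lemma is_right_adjoint_comp (X Y Z : cdtop) (g : cdtop_hom Y Z)
  (f : cdtop_hom X Y) : is_right_adjoint (g \o f).
Proof.
have [[h hf] [k kg]] := (cdtop_funP f, cdtop_funP g).
by exists (h \o k); apply: adjoint_comp.
Qed.

Definition cdtop_id (A : cdtop) : cdtop_hom A A := CDTopHom (@is_right_adjoint_id A).

Definition cdtop_comp (A B C : cdtop) (g : cdtop_hom B C) (f : cdtop_hom A B) :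
    cdtop_hom A C := CDTopHom (is_right_adjoint_comp g f).

Lemma cdtop_compm1 (A B : cdtop) (f : cdtop_hom A B) :
  cdtop_comp f (cdtop_id A) = f.
Proof. exact: cdtop_hom_inj. Qed.

Lemma cdtop_comp1m (A B : cdtop) (f : cdtop_hom A B) :
  cdtop_comp (cdtop_id B) f = f.
Proof. exact: cdtop_hom_inj. Qed.

Lemma cdtop_compmA (A B C D : cdtop) (h : cdtop_hom C D) (g : cdtop_hom B C)
    (f : cdtop_hom A B) :
  cdtop_comp h (cdtop_comp g f) = cdtop_comp (cdtop_comp h g) f.
Proof. exact: cdtop_hom_inj. Qed.

Definition CDTop_inf : category :=
  Category cdtop_compm1 cdtop_comp1m cdtop_compmA.

Lemma lfilter_map_right_adjoint (L M : frame) (f : frame_hom L M) :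
  is_right_adjoint (lfilter_map (frame_funP f)).
Proof. by exists (lfilter_comap (frame_funP f)); apply: lfilter_map_adjoint. Qed.

Definition F_map (L M : frame) (f : frame_hom L M) :
    cdtop_hom (filter_space L) (filter_space M) :=
  @CDTopHom (filter_space L) (filter_space M) _ (lfilter_map_right_adjoint f).

Lemma F_map1 (L : Frm_meet) : F_map (idm L) = idm (filter_space L : CDTop_inf).
Proof.
apply: cdtop_hom_inj => f; apply/lfilter_inj/seteqP; split=> [y [x fx xy]|y fy].
  exact: lfilterS fx.
by exists y.
Qed.

Lemma F_mapM (L M N : Frm_meet) (g : hom M N) (f : hom L M) :
  F_map (g \oc f) = (F_map g : hom (c := CDTop_inf) _ _) \oc F_map f.
Proof.
apply: cdtop_hom_inj => u; apply/lfilter_inj/seteqP; split=> z.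
  by move=> [x ux xz]; exists (f x) => //; exists x.
move=> [y [x ux xy] yz]; exists x => //; apply: le_trans yz.
exact: (meet_hom_homo (frame_funP g)).
Qed.

Definition F_functor : functor Frm_meet CDTop_inf :=
  @Functor Frm_meet CDTop_inf (fun L : frame => filter_space L) F_map F_map1 F_mapM.

(* The left adjoint is unique, as the spaces are T0. *)
Definition ladj (X Y : cdtop) (f : cdtop_hom X Y) : Y -> X :=
  projT1 (cid (cdtop_funP f)).

Lemma ladjP (X Y : cdtop) (f : cdtop_hom X Y) : adjoint (ladj f) f.
Proof. exact: projT2 (cid (cdtop_funP f)). Qed.

Lemma ladj_unique (X Y : cdtop) (f : cdtop_hom X Y) (g : Y -> X) :
  adjoint g f -> ladj f = g.
Proof. exact: left_adjoint_unique (@cdtop_T0 X) (ladjP f). Qed.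

Lemma Pt_map_subproof (X Y : cdtop) (f : cdtop_hom X Y) (phi : Lambda X) :
  is_left_adjoint (phi \o ladj f).
Proof.
have [g phig] := LambdaP phi; exists (f \o g).
exact: adjoint_comp (ladjP f) phig.
Qed.

Definition Pt_fun (X Y : cdtop) (f : cdtop_hom X Y) (phi : Pt X) : Pt Y :=
  MkLambda (Pt_map_subproof f phi).

Lemma Pt_fun_meet_hom (X Y : cdtop) (f : cdtop_hom X Y) :
  meet_hom (Pt_fun f).
Proof. by split=> [|phi psi]; apply: Lambda_inj. Qed.

Definition Pt_frame (X : cdtop) : frame := @MkFrame _ (Pt X).

Definition Pt_map (X Y : cdtop) (f : cdtop_hom X Y) :
    frame_hom (Pt_frame X) (Pt_frame Y) :=
  @FrameHom (Pt_frame X) (Pt_frame Y) _ (Pt_fun_meet_hom f).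

Lemma Pt_map1 (X : CDTop_inf) : Pt_map (idm X) = idm (Pt_frame X : Frm_meet).
Proof.
apply: frame_hom_inj => phi; apply: Lambda_inj => x /=.
by rewrite (@ladj_unique _ _ (cdtop_id X) _ (adjoint_id X)).
Qed.

Lemma Pt_mapM (X Y Z : CDTop_inf) (g : hom Y Z) (f : hom X Y) :
  Pt_map (g \oc f) = (Pt_map g : hom (c := Frm_meet) _ _) \oc Pt_map f.
Proof.
apply: frame_hom_inj => phi; apply: Lambda_inj => x /=.
rewrite (@ladj_unique _ _ (cdtop_comp g f) (ladj f \o ladj g)) //.
exact: adjoint_comp (ladjP g) (ladjP f).
Qed.

Definition Pt_functor : functor CDTop_inf Frm_meet :=
  @Functor CDTop_inf Frm_meet Pt_frame Pt_map Pt_map1 Pt_mapM.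

(* Main.v *)
From mathcomp Require Import all_boot all_order.
From mathcomp Require Import boolp classical_sets.
From mathcomp Require Import topology_structure separation_axioms.
Require Import Defs.

(** An element of [Pt X] is a point [r] of [X] whose down-set is open.
    In a filter space [F L] these are exactly the principal filters, so
    [L] is isomorphic to [Pt (F L)].  In a completely distributive T0-space
    [Sup \o t] is the identity, which forces the open principal down-sets to
    form a basis; hence sending [x] to the filter of the principal open
    neighbourhoods of [x] embeds [X] into [F (Pt X)], with inverse sending a
    filter to the supremum of the filter of opens it generates. *)

Set Implicit Arguments.
Unset Strict Implicit.
Unset Printing Implicit Defensive.

Import Order.TTheory.
Local Open Scope classical_set_scope.
Local Open Scope order_scope.

#[local] Identity Coercion fun_of_set : set >-> Funclass.

Lemma adjoint_cancel (X Y : topologicalType) (f : X -> Y) (g : Y -> X) :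
  continuous f -> continuous g -> cancel f g -> cancel g f -> adjoint f g.
Proof.
by move=> cf cg fK gK; split=> // x /=; rewrite ?fK ?gK; apply: under_le_refl.
Qed.

(** With its section [g], the order embedding [f] is an order isomorphism, so it preserves the top
    and binary meets, which the order determines. *)
Lemma meet_hom_iso d d' (L : tMeetSemilatticeType d)
    (M : tMeetSemilatticeType d') (f : L -> M) (g : M -> L) :
  {mono f : x y / x <= y} -> cancel g f -> meet_hom f.
Proof.
move=> fle gK; split=> [|x y]; apply/eqP; rewrite eq_le.
  by rewrite lex1 -[\top as X in X <= _]gK fle lex1.
by rewrite lexI !fle leIl leIr -[f x `&` f y]gK fle lexI -!fle gK leIl leIr.
Qed.

Section FilterSpacePoints.
Variables (d : Order.disp_t) (L : frameType d).
Implicit Types x y : L.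

(** Filters are ordered by reverse inclusion, and a filter includes [principal x] exactly when it
    contains [x]. *)
Lemma principal_downset x :
  [set f : filter_space L | under_le f (principal x)] = sharp x.
Proof.
apply/seteqP; split=> f /=; first by move=> /lfilter_leP; apply; apply: lexx.
by move=> fx; apply/lfilter_leP => y /= xy; apply: lfilterS fx.
Qed.

Lemma principal_downset_open x :
  open [set f : filter_space L | under_le f (principal x)].
Proof. by rewrite principal_downset; apply: open_sharp. Qed.

Definition principal_point x : Pt (filter_space L) :=
  of_point (principal_downset_open x).

Lemma principal_pointP x (f : lfilter L) :
  (principal_point x : Lambda (filter_space L)) f = false <-> f x.
Proof.
have e := congr1 (fun A : set (lfilter L) => A f) (principal_downset x).
by rewrite [X in _ <-> X](_ : _ = sharp x f) // -e; apply: of_pointP.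
Qed.

Lemma principal_point_mono : {mono principal_point : x y / x <= y}.
Proof.
move=> x y; apply/idP/idP => [/PtE h|xy].
  by apply/(principal_pointP y (principal x))/h/principal_pointP => /=.
by apply/PtE => f /principal_pointP fx; apply/principal_pointP/(lfilterS xy).
Qed.

(** The open down-set of [point phi] contains a basic open [sharp x] around [point phi]. As
    [principal x] is the largest element of [sharp x], it equals [point phi]. *)
Lemma principal_point_surj (phi : Pt (filter_space L)) :
  exists x, principal_point x = phi.
Proof.
have /lfilter_openE/(_ _ (@under_le_refl _ (point phi)))[x px xp] :=
  point_open phi.
have /lfilter_leP px' : under_le (principal x) (point phi) by apply: xp => /=.
exists x; apply/eqP; rewrite eq_le; apply/andP; split; apply/PtE => f.
  by move=> /principal_pointP fx; apply/pointP/xp.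
move=> /pointP/lfilter_leP pf; apply/principal_pointP; exact: pf.
Qed.

Definition point_generator (phi : Pt (filter_space L)) : L :=
  projT1 (cid (principal_point_surj phi)).

Lemma point_generatorK : cancel point_generator principal_point.
Proof. by move=> phi; rewrite /point_generator; case: cid. Qed.

Lemma principal_pointK : cancel principal_point point_generator.
Proof. by apply: (inj_can_sym point_generatorK) (inc_inj principal_point_mono). Qed.

Lemma meet_hom_principal_point : meet_hom principal_point.
Proof. exact: meet_hom_iso principal_point_mono point_generatorK. Qed.

Lemma meet_hom_point_generator : meet_hom point_generator.
Proof.
apply: (meet_hom_iso _ principal_pointK) => phi psi.
by rewrite -principal_point_mono !point_generatorK.
Qed.

End FilterSpacePoints.

Section PointsBasis.
Variable X : cdtop.

Definition Sup : presheaf X -> X := projT1 (cid (cdtop_cd X)).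

Lemma Sup_adjoint : adjoint Sup (@yoneda X).
Proof. by rewrite /Sup; case: cid => S []. Qed.

Lemma Sup_right_adjoint : is_right_adjoint Sup.
Proof. by rewrite /Sup; case: cid => S []. Qed.

(** The Yoneda embedding reflects the order, so its left adjoint inverts it up to equivalence, and
    T0 gives equality. *)
Lemma Sup_yoneda : cancel (@yoneda X) Sup.
Proof.
move=> x; apply: under_le_anti; first exact: cdtop_T0.
  by apply/(adjointP Sup_adjoint)/under_le_refl.
have [_ _ /(_ (yoneda x))/lfilter_leP/= h _] := Sup_adjoint.
by apply/under_leP => V oV; apply: (h (Opens oV)).
Qed.

Lemma open_downset_basis (U : opens X) (x : X) : U x ->
  exists phi : Pt X, zeros phi x /\ zeros phi `<=` U.
Proof.
have [t tA] := Sup_right_adjoint; move=> Ux.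
have [ct /continuousP cS tS St] := tA.
(* From [x = Sup (yoneda x)] the adjunction gives [t x] below [yoneda x]. Opens are down-closed, so
   [U] contains [Sup (t x)]. *)
have StK : under_le (Sup (t x)) x.
  rewrite -{2}[x]Sup_yoneda; apply: under_le_homo; first exact/continuousP.
  by apply/(adjointP tA); rewrite Sup_yoneda; apply: under_le_refl.
have USt : U (Sup (t x)) by apply: (proj1 (under_leP _ _) StK) => //; apply: opensP.
(* Continuity of [Sup] at [t x] yields [V]. The required point is [Sup (principal V)]: it lies in
   [U], and its down-set is the preimage of [sharp V] under [t], hence open. *)
have /lfilter_openE/(_ _ USt)[V tV VU] := cS _ (opensP U).
have tP z : under_le z (Sup (principal V)) <-> t z V.
  rewrite -(adjointP tA); split=> [/lfilter_leP|tzV]; first by apply; apply: lexx.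
  by apply/lfilter_leP => W VW; apply: lfilterS tzV.
have or : open [set z | under_le z (Sup (principal V))].
  rewrite (_ : [set _ | _] = t @^-1` sharp V).
    by move/continuousP: ct; apply; apply: open_sharp.
  by apply/seteqP; split=> z /tP.
exists (of_point or); split=> [|z /pointP/of_pointP zV].
  by apply/pointP/of_pointP/tP.
apply: (proj1 (under_leP _ _) zV); first exact: opensP.
by apply: (VU (principal V)) => /=.
Qed.

Lemma meet_hom_zeros : meet_hom (@zeros X : Pt X -> opens X).
Proof.
split=> [|phi psi]; apply/opens_inj/seteqP; split=> z //=.
- by move=> _; apply/pointP.
- move=> /pointP/negbT; rewrite negb_or => /andP[/negbTE ? /negbTE ?].
  by split; apply/pointP.
- by move=> [/pointP h /pointP h']; apply/pointP; rewrite /Order.meet /= h h'.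
Qed.

(** Both this map and [of_filters] are composites of maps from known adjunctions, which makes them
    continuous. *)
Definition to_filters (x : X) : filter_space (Pt X) :=
  lfilter_comap meet_hom_zeros (yoneda x).

Definition of_filters (f : filter_space (Pt X)) : X :=
  Sup (lfilter_map meet_hom_zeros f).

Lemma to_filters_continuous : continuous to_filters.
Proof.
apply: continuous_comp_fun; first by have [] := Sup_adjoint.
by have [] := lfilter_map_adjoint meet_hom_zeros.
Qed.

Lemma of_filters_continuous : continuous of_filters.
Proof.
apply: continuous_comp_fun; last by have [] := Sup_adjoint.
by have [] := lfilter_map_adjoint meet_hom_zeros.
Qed.

(** By [open_downset_basis], the principal open neighbourhoods of [x] generate the whole filter
    [yoneda x]. *)
Lemma to_filtersK : cancel to_filters of_filters.
Proof.
move=> x; rewrite -[RHS]Sup_yoneda; congr Sup.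
apply/lfilter_inj/seteqP; split=> U /= => [[phi phix /asboolP]|Ux]; first exact.
have [phi [phix phiU]] := open_downset_basis Ux.
by exists phi => //; apply/asboolP.
Qed.

(** By adjunction, [of_filters f] is below [point phi] iff every open neighbourhood of [point phi]
    is in the filter generated by [f]. The least such neighbourhood is [zeros phi]. *)
Lemma of_filtersK : cancel of_filters to_filters.
Proof.
move=> f; apply/lfilter_inj/seteqP; split=> phi /=.
  move=> /(adjointP Sup_adjoint)/lfilter_leP/(_ (zeros phi)).
  move=> /(_ (@under_le_refl _ (point phi)))[psi fpsi /asboolP zle].
  by apply: lfilterS fpsi; apply/PtE => z /pointP/zle/pointP.
move=> fphi; apply/(adjointP Sup_adjoint)/lfilter_leP => U Up.
exists phi => //; apply/asboolP => z /under_leP; apply => //; exact: opensP.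
Qed.

Lemma of_filters_right_adjoint : is_right_adjoint of_filters.
Proof.
exists to_filters; apply: adjoint_cancel to_filtersK of_filtersK.
  exact: to_filters_continuous.
exact: of_filters_continuous.
Qed.

Lemma to_filters_right_adjoint : is_right_adjoint to_filters.
Proof.
exists of_filters; apply: adjoint_cancel of_filtersK to_filtersK.
  exact: of_filters_continuous.
exact: to_filters_continuous.
Qed.

End PointsBasis.

Lemma to_filters_natural (X Y : cdtop) (f : cdtop_hom X Y) (x : X) :
  F_map (Pt_map f) (to_filters x) = to_filters (f x).
Proof.
have [cl cf lf fl] := ladjP f.
apply/lfilter_inj/seteqP; split=> psi /=.
  move=> [phi /pointP phix /PtE phipsi]; apply/pointP/phipsi => /=.
  by apply/pointP/(under_le_trans (fl x))/pointP.
move=> psifx.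
have oU : open (f @^-1` zeros psi).
  by move/continuousP: cf; apply; apply: opensP.
(* The basis supplies [phi]; the unit [z <= f (ladj f z)] then puts its image under [Pt_map f] below
   [psi]. *)
have [phi [phix phiU]] := @open_downset_basis X (Opens oU) x psifx.
exists phi => //; apply/PtE => z /= /pointP /phiU /= h.
exact/pointP/(under_le_trans (lf z)).
Qed.

Lemma F_Pt_unit : naturally_isomorphic (functor_id Frm_meet)
  (functor_comp Pt_functor F_functor).
Proof.
pose eta (L : Frm_meet) : hom L (functor_comp Pt_functor F_functor L) :=
  @FrameHom L (Pt_frame (filter_space L)) _ (@meet_hom_principal_point _ L).
exists eta; split=> [L M f|L].
  apply: frame_hom_inj => x; apply: Lambda_inj => g /=.
  (* The left adjoint of [F_map f] takes preimages, so both sides vanish at [g] exactly when [g]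
     contains [f x]. *)
  rewrite (@ladj_unique _ _ (F_map f) _ (lfilter_map_adjoint (frame_funP f))).
  have h : (principal_point (f x) : Lambda (filter_space M)) g = false <->
      (principal_point x : Lambda (filter_space L))
        (lfilter_comap (frame_funP f) g) = false.
    by rewrite principal_pointP [X in _ <-> X]principal_pointP.
  apply/idP/idP; apply: contraTT => /negbTE e; apply/negbT; exact/h.
exists (@FrameHom (Pt_frame (filter_space L)) L _
  (@meet_hom_point_generator _ L)).
by split; apply: frame_hom_inj => x /=; [apply: principal_pointK|apply: point_generatorK].
Qed.

Lemma F_Pt_counit : naturally_isomorphic (functor_comp F_functor Pt_functor)
  (functor_id CDTop_inf).
Proof.
pose eps (X : CDTop_inf) : hom (functor_comp F_functor Pt_functor X) X :=
  @CDTopHom (filter_space (Pt X)) X _ (@of_filters_right_adjoint X).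
exists eps; split=> [X Y f|X].
  apply: cdtop_hom_inj => u.
  (* Naturality passes from [to_filters] to its inverse. *)
  rewrite -[u](@of_filtersK X); set x := of_filters u.
  transitivity (of_filters (F_map (Pt_map f) (to_filters x))); first by [].
  by rewrite to_filters_natural /= !to_filtersK.
exists (@CDTopHom X (filter_space (Pt X)) _ (@to_filters_right_adjoint X)).
by split; apply: cdtop_hom_inj => x /=; [apply: of_filtersK|apply: to_filtersK].
Qed.

Theorem theorem7p14 : is_equivalence F_functor Pt_functor.
Proof. exact: conj F_Pt_unit F_Pt_counit. Qed.
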